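(* Let $\Lambda$ be a compact minimal set of a $C^0$ non-wandering flow on a connected manifold $M$. Then, either (1) there is a sequence of Lyapunov unstable compact minimal sets $\Lambda_n$ converging to $\Lambda$ in the Hausdorff metric, or (2) $\Lambda = M$, i.e. $M$ is compact and the flow is minimal, or (3) there are arbitrarily small compact, connected, invariant neighbourhoods $U$ of $\Lambda$ in $M$ such that: (a) $U$ is the union of $\mathfrak{c}=|\mathbb{R}|$ (pairwise distinct) Lyapunov stable compact minimal sets $\Lambda_i$, $i\in\mathbb{R}$; (b) endowed with the Hausdorff metric, the set $\{\Lambda_i : i\in\mathbb{R}\}$ is a Peano continuum.
   Context: An $n$-manifold is a separable metric space locally homeomorphic to the $n$-cell $\mathbb{D}^n=\{x\in\mathbb{R}^n:|x|\le 1\}$ (possibly noncompact, possibly with boundary). A $C^0$ flow on $M$ is a continuous action of $(\mathbb{R},+)$ on $M$, written $(t,x)\mapsto x^t$. The flow is non-wandering if every point of $M$ is non-wandering (for every neighbourhood $V$ of $x$ and every $T>0$ there is $t\ge T$ with $V^t\cap V\neq\emptyset$). A minimal set is a nonempty closed invariant set containing no smaller nonempty closed invariant set; the flow is minimal if $M$ is a minimal set. A neighbourhood of a set $Y$ is a set whose interior contains $Y$. ''Arbitrarily small neighbourhoods $U$ of $\Lambda$ with property P'' means that every neighbourhood of $\Lambda$ contains a neighbourhood $U$ of $\Lambda$ with property P. A nonempty compact invariant set $K$ is Lyapunov stable if every neighbourhood of $K$ contains a neighbourhood $V$ of $K$ that is positively invariant ($x^t\in V$ for all $x\in V$, $t\ge0$);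 otherwise it is Lyapunov unstable. A Peano continuum is a compact, connected and locally connected metric space. *)

(* Defs.v *)
From HB Require Import structures.
From mathcomp Require Import all_boot all_order all_algebra.
From mathcomp Require Import all_classical all_reals all_analysis.

Set Implicit Arguments.
Unset Strict Implicit.
Unset Printing Implicit Defensive.

Import Order.TTheory GRing.Theory Num.Theory.
Import numFieldNormedType.Exports.
Local Open Scope classical_set_scope.
Local Open Scope ring_scope.

Section topology.

Definition separable_space (T : topologicalType) : Prop :=
  exists2 D : set T, countable D & dense D.

(* A and B are homeomorphic for their subspace topologies; f and g matter only
   on A and B respectively. *)
Definition homeomorphic_sets (T U : topologicalType) (A : set T) (B : set U) :
    Prop :=
  exists (f : T -> U) (g : U -> T),
    [/\ set_fun A B f /\ set_fun B A g,
        forall x, A x -> g (f x) = x,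
        forall y, B y -> f (g y) = y,
        {within A, continuous f} &
        {within B, continuous g}].

(* Local connectedness of the subspace A: the sets V `&` A with V open are the
   relatively open subsets of A. *)
Definition locally_connected_set (T : topologicalType) (A : set T) : Prop :=
  forall x (W : set T), A x -> open W -> W x ->
    exists V : set T, [/\ open V, V x, V `&` A `<=` W & connected (V `&` A)].

Definition Peano_continuum (R : realType) (T : metricType R) (A : set T) :
    Prop :=
  [/\ compact A, connected A & locally_connected_set A].

End topology.

Section manifold.

(* The row-vector type carries the sup norm, which induces the same topology,
   but the cell is defined with the Euclidean norm. *)
Definition cell (R : realType) (n : nat) : set 'rV[R]_n :=
  [set x | Num.sqrt (\sum_(i < n) x ord0 i ^+ 2) <= 1].

Definition manifold (R : realType) (n : nat) (M : metricType R) : Prop :=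
  separable_space M /\
  forall x : M, exists (V : set M) (W : set 'rV[R]_n),
    [/\ open V, V x, open W & homeomorphic_sets V (W `&` @cell R n)].

End manifold.

Section hausdorff_metric.
Context {R : realType} {M : metricType R}.

Definition hausdorff_radii (A B : set M) : set R :=
  [set e | [/\ 0 < e,
               forall a, A a -> exists2 b, B b & mdist a b < e &
               forall b, B b -> exists2 a, A a & mdist b a < e]].

Definition hausdorff_dist (A B : set M) : R := inf (hausdorff_radii A B).

End hausdorff_metric.

Record hyperspace (R : realType) (M : metricType R) := Hyperspace {
  hyperspace_set :> set M ;
  hyperspace_neq0 : hyperspace_set !=set0 ;
  hyperspace_compact : compact hyperspace_set }.

HB.instance Definition _ (R : realType) (M : metricType R) :=
  gen_eqMixin (hyperspace M).
HB.instance Definition _ (R : realType) (M : metricType R) :=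
  gen_choiceMixin (hyperspace M).

Section hyperspace_metric.
Context {R : realType} {M : metricType R}.
Implicit Types (A B C : set M) (K L N : hyperspace M).

Lemma hyperspace_inj K L : K = L :> set M -> K = L.
Proof.
case: K => K K0 cK; case: L => L L0 cL /= KL; subst L.
by congr Hyperspace; exact: Prop_irrelevance.
Qed.

Let radii_lb A B : lbound (hausdorff_radii A B) 0.
Proof. by move=> e [/ltW]. Qed.

Let radii_has_lb A B : has_lbound (hausdorff_radii A B).
Proof. by exists 0; exact: radii_lb. Qed.

Let radii_sym A B : hausdorff_radii A B = hausdorff_radii B A.
Proof. by apply/seteqP; split=> e [e0 ? ?]; split. Qed.

Let mdist_cont (a : M) : continuous (mdist a : M -> R).
Proof.
move=> x; apply/cvgrPdist_lt => e e0.
have : nbhs x (ball x e) by exact: nbhsx_ballx.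
apply: filterS => y; rewrite ballEmdist/= => xy.
have := metric_triangle a x y; have := metric_triangle a y x.
rewrite (metric_sym y x) => ayx axy; rewrite ltr_norml; apply/andP.
split; [rewrite ltrNl opprB|]; rewrite ltrBlDl.
  by apply: le_lt_trans axy _; rewrite ltrD2l.
by apply: le_lt_trans ayx _; rewrite ltrD2l.
Qed.

Let compact_dist_bounded K (a : M) :
  exists2 r : R, 0 < r & forall x, hyperspace_set K x -> mdist a x < r.
Proof.
have cI : compact ((mdist a : M -> R) @` K).
  apply: continuous_compact; last exact: hyperspace_compact.
  by apply: continuous_subspaceT => x; exact: mdist_cont.
have [r [rreal hr]] := compact_bounded cI.
exists (`|r| + 2); first by rewrite ltr_wpDl.
move=> x Kx.
have /(_ (mdist a x)) : globally ((mdist a : M -> R) @` K)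
    [set y : R | `|y| <= `|r| + 1].
  by apply: hr; rewrite (le_lt_trans (ler_norm r))// ltrDl.
move=> /(_ (ex_intro2 _ _ x Kx erefl)) /= h.
rewrite (le_lt_trans (ler_norm _))// (le_lt_trans h)// ltrD2l.
by rewrite ltr1n.
Qed.

Let radii_neq0 K L : hausdorff_radii K L !=set0.
Proof.
have [a Ka] := hyperspace_neq0 K; have [b Lb] := hyperspace_neq0 L.
have [r r0 hr] := compact_dist_bounded K b.
have [s s0 hs] := compact_dist_bounded L a.
exists (r + s); split; first by rewrite addr_gt0.
- move=> x Kx; exists b => //.
  by rewrite metric_sym (lt_le_trans (hr _ Kx))// lerDl ltW.
- move=> y Ly; exists a => //.
  by rewrite metric_sym (lt_le_trans (hs _ Ly))// lerDr ltW.
Qed.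

Let hausdorff_distxx K : hausdorff_dist K K = 0.
Proof.
apply/eqP; rewrite eq_le; apply/andP; split; last first.
  by apply: lb_le_inf; [exact: radii_neq0 | exact: radii_lb].
apply/ler_addgt0Pr => e e0; rewrite add0r; apply: ge_inf => //.
by split=> // x Kx; exists x; rewrite // mdistxx.
Qed.

Let hausdorff_dist_lt K L e : hausdorff_dist K L < e ->
  forall x, hyperspace_set K x -> exists2 y, hyperspace_set L y & mdist x y < e.
Proof.
move=> /(inf_lt (radii_neq0 K L))[].
move=> d [d0 KL _] de x /KL[y Ly xy]; exists y => //.
exact: lt_trans xy de.
Qed.

Let hausdorff_dist_sub K L : hausdorff_dist K L = 0 -> K `<=` L.
Proof.
move=> KL0 x Kx.
have cL : closed (L : set M).
  by apply: compact_closed; [exact: metric_hausdorff|exact: hyperspace_compact].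
apply: cL => B; rewrite -nbhs_ballE => -[e /= e0 xeB].
have [|y Ly xy] := @hausdorff_dist_lt K L e _ x Kx; first by rewrite KL0.
by exists y; split => //; apply: xeB; rewrite ballEmdist.
Qed.

Let hausdorff_dist_sym K L : hausdorff_dist K L = hausdorff_dist L K.
Proof. by rewrite /hausdorff_dist radii_sym. Qed.

Let hausdorff_dist_eq0 K L : hausdorff_dist K L = 0 -> K = L.
Proof.
move=> KL; apply: hyperspace_inj; apply/seteqP.
by split; apply: hausdorff_dist_sub; rewrite // hausdorff_dist_sym.
Qed.

Let hausdorff_dist_triangle L K N :
  hausdorff_dist K N <= hausdorff_dist K L + hausdorff_dist L N.
Proof.
apply/ler_addgt0Pr => e e0.
have KL : hausdorff_dist K L < hausdorff_dist K L + e / 2.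
  by rewrite ltrDl divr_gt0.
have LN : hausdorff_dist L N < hausdorff_dist L N + e / 2.
  by rewrite ltrDl divr_gt0.
have ge0 A B : hausdorff_radii A B !=set0 -> 0 <= hausdorff_dist A B.
  by move=> AB; apply: lb_le_inf => //; exact: radii_lb.
rewrite [e in leRHS]splitr addrACA; apply: ge_inf => //; split.
- by rewrite addr_gt0// ltr_wpDl ?divr_gt0 ?ge0//; exact: radii_neq0.
- move=> x Kx; have [y Ly xy] := hausdorff_dist_lt KL Kx.
  have [z Nz yz] := hausdorff_dist_lt LN Ly; exists z => //.
  by rewrite (le_lt_trans (metric_triangle x y z))// ltrD.
- rewrite hausdorff_dist_sym in KL; rewrite hausdorff_dist_sym in LN.
  move=> x Nx; have [y Ly xy] := hausdorff_dist_lt LN Nx.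
  have [z Kz yz] := hausdorff_dist_lt KL Ly; exists z => //.
  rewrite (le_lt_trans (metric_triangle x y z))// addrC.
  by rewrite (hausdorff_dist_sym K L) (hausdorff_dist_sym L N) ltrD.
Qed.

HB.instance Definition _ := @isMetric.Build R (hyperspace M)
  (fun K L => hausdorff_dist K L) hausdorff_distxx hausdorff_dist_eq0
  hausdorff_dist_sym hausdorff_dist_triangle.

End hyperspace_metric.

Section flow.
Context {R : realType} {M : metricType R}.
Implicit Types (phi : R -> M -> M) (A K U V : set M).

Definition C0_flow phi : Prop :=
  [/\ continuous (fun p : R * M => phi p.1 p.2),
      forall x, phi 0 x = x &
      forall s t x, phi (s + t) x = phi s (phi t x)].

Definition nonwandering_point phi (x : M) : Prop :=
  forall V, nbhs x V -> forall T : R, 0 < T ->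
    exists2 t : R, T <= t & (phi t @` V) `&` V !=set0.

Definition nonwandering phi : Prop := forall x, nonwandering_point phi x.

Definition flow_invariant phi A : Prop :=
  forall (t : R) x, A x -> A (phi t x).

Definition positively_invariant phi A : Prop :=
  forall (t : R) x, 0 <= t -> A x -> A (phi t x).

Definition minimal_set phi A : Prop :=
  [/\ A !=set0, closed A, flow_invariant phi A &
      forall B : set M, B !=set0 -> closed B -> flow_invariant phi B ->
        B `<=` A -> B = A].

Definition minimal_flow phi : Prop := minimal_set phi [set: M].

(* Only meaningful for nonempty compact invariant K, which compact minimal sets
   are. *)
Definition Lyapunov_stable phi K : Prop :=
  forall N : set M, set_nbhs K N ->
    exists V, [/\ set_nbhs K V, V `<=` N & positively_invariant phi V].

Definition Lyapunov_unstable phi K : Prop := ~ Lyapunov_stable phi K.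

End flow.

(* Main.v *)
Require Import Defs.
From mathcomp Require Import all_boot all_order all_algebra.
From mathcomp Require Import all_classical all_reals all_analysis.
From mathcomp Require Import ring lra.

Set Implicit Arguments.
Unset Strict Implicit.
Unset Printing Implicit Defensive.

Import Order.TTheory GRing.Theory Num.Theory.
Import numFieldNormedType.Exports.
Local Open Scope classical_set_scope.
Local Open Scope ring_scope.

(** Suppose that no sequence of unstable compact minimal sets converges to
    [Lam] and that [Lam] is not the whole manifold; then every minimal set
    that is Hausdorff-close to [Lam] is stable, [Lam] included.

    In a non-wandering flow, stability improves to invariance: if an open set
    [A] is carried into itself by positive times, a point of [A] whose backward
    orbit left the closure of [A] would be wandering.  So a stable minimal set
    has arbitrarily small neighbourhoods that are open, connected and invariant,
    with compact closure ([stable_invariant_nbhs]).  Minimal sets contained in a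
    small neighbourhood of a minimal set [K] are Hausdorff-close to [K]
    ([minimal_near_hausdorff]).  Hence [Lam] has a compact invariant
    neighbourhood [X], as small as desired, all of whose minimal subsets are
    stable.  The orbit closure of a point [x] of [X] contains a minimal set,
    which is stable; its small invariant neighbourhoods meet the orbit of [x],
    so they contain [x], and [x] lies in that minimal set.  Thus [X] is
    partitioned into minimal sets, and the map [q] that sends a point to its
    minimal set is continuous for the Hausdorff metric
    ([stable_decomposition]).

    The boundary of [X] may be wild, so [q @` X] need not be locally connected.
    Instead, [Lam] is covered by finitely many small closed cells of [M] that
    meet it; their union [C] is a Peano continuum ([Peano_cover]).
    Local connectedness passes to continuous images of compact sets
    ([locally_connected_image]), so [q @` C] is a Peano continuum, and [U] is
    the union of the minimal sets that meet [C].

    For the cardinality, [q @` C] is connected, and it has at least two points,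
    because otherwise [Lam] would be open and closed in [M]; so it has at least
    as many points as [R] ([connected_card_ge]).  It has at most as many because
    compact subsets of a separable metric space are encoded by binary sequences
    ([hyperspace_card_le]). *)

(** * Compactness and local connectedness *)

(** The compactness principle behind both finite coverings below: the sets
    [K `\` C^°] with [P C] form a filter base. If none of them were empty, they
    would cluster at some point of [K], but that point has a neighbourhood [C]
    with [P C]. *)
Lemma compact_cover_ind (T : topologicalType) (K : set T) (P : set (set T)) :
  compact K -> P set0 -> (forall A B, P A -> P B -> P (A `|` B)) ->
  (forall x, K x -> exists2 C, nbhs x C & P C) ->
  exists2 C, set_nbhs K C & P C.
Proof.
move=> cK P0 PU PK; apply: contrapT => nC.
pose F := filter_from P (fun C => K `\` C^°).
have FF : ProperFilter F.
  apply: filter_from_proper.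
    apply: filter_from_filter; first by exists set0.
    move=> A B PA PB; exists (A `|` B); first exact: PU.
    move=> x [Kx nAB]; split; split=> // ?; apply: nAB.
      exact: (interiorS (@subsetUl _ A B)).
    exact: (interiorS (@subsetUr _ A B)).
  move=> C PC; apply: contrapT => /nonemptyPn; rewrite setD_eq0 => KC.
  by apply: nC; exists C => // x Kx; exact: KC.
have [|x [Kx clx]] := cK F FF; first by exists set0 => // x [].
have [C xC PC] := PK _ Kx.
have [||y [[_ nCy] Cy]] := clx (K `\` C^°) C^°.
- by exists C.
- by apply: nbhs_interior.
- exact: nCy.
Qed.

Lemma within_continuous_nbhs (T U : topologicalType) (A : set T) (f : T -> U)
    (x : T) (W : set U) :
  {within A, continuous f} -> A x -> open W -> W (f x) ->
  exists V, [/\ open V, V x & V `&` A `<=` f @^-1` W].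
Proof.
move=> cf Ax oW Wfx; have /continuousP/(_ _ oW)/open_subspaceP[V oV VA] := cf.
exists V; split => //.
  have : (f @^-1` W `&` A) x by [].
  by rewrite -VA => -[].
by rewrite VA => y [].
Qed.

(** The hypothesis says that [G] is relatively open in [A]. Both permanence
    properties of local connectedness below reduce to it, with [G] a connected
    component. *)
Lemma closed_setD_relopen (T : topologicalType) (A G : set T) :
  closed A ->
  (forall x, A x -> G x -> exists V, [/\ open V, V x & V `&` A `<=` G]) ->
  closed (A `\` G).
Proof.
move=> cA AG x clx; have Ax : A x by apply: cA; exact: closureS clx.
split => // Gx; have [V [oV Vx VG]] := AG _ Ax Gx.
have [y [[Ay nGy] Vy]] := clx V (open_nbhs_nbhs (conj oV Vx)).
by apply: nGy; apply: VG.
Qed.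

(** Local connectedness amounts to components of relatively open sets being
    relatively open; the complement of [S `\` G] is then the required open
    set. This form suits images and finite unions, where it is closedness that
    transfers. *)
Lemma locally_connected_closed (T : topologicalType) (S : set T) :
  (forall W x, open W -> (W `&` S) x ->
    closed (S `\` connected_component (W `&` S) x)) ->
  locally_connected_set S.
Proof.
move=> cS x W Sx oW Wx; pose G := connected_component (W `&` S) x.
have VS : ~` (S `\` G) `&` S = G.
  apply/seteqP; split => y.
    by move=> [nSG Sy]; apply: contrapT => nG; exact: nSG.
  move=> Gy; have [] := @connected_component_sub _ _ _ _ Gy; split => // -[_].
  exact.
exists (~` (S `\` G)); split.
- by apply: closed_openC; exact: cS.
- by move=> [_]; apply; apply: connected_component_refl.
- by rewrite VS => y /connected_component_sub[].
- by rewrite VS; exact: component_connected.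
Qed.

(** A component of a relatively open subset of [A `|` B] traces a relatively
    open set on each piece, since each piece is locally connected. *)
Lemma locally_connected_setU (T : topologicalType) (A B : set T) :
  closed A -> closed B -> locally_connected_set A -> locally_connected_set B ->
  locally_connected_set (A `|` B).
Proof.
move=> cA cB lA lB; apply: locally_connected_closed => W x oW WSx.
rewrite setDUl; set S := A `|` B; set G := connected_component _ x.
have piece C : C `<=` S -> closed C -> locally_connected_set C -> closed (C `\` G).
  move=> CS cC lC; apply: closed_setD_relopen => // y Cy Gy.
  have [Wy Sy] := @connected_component_sub _ _ _ _ Gy.
  have [V [oV Vy VW cV]] := lC y W Cy oW Wy; exists V; split => // z VCz.
  apply: (@connected_component_trans _ _ y) => //.
  apply: (@connected_component_max _ _ (V `&` C)) => // t VCt; split.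
    exact: VW.
  by apply: CS; case: VCt.
apply: closedU; apply: piece => //; [exact: subsetUl|exact: subsetUr].
Qed.

(** A continuous map from a compact set to a Hausdorff space is a quotient map
    onto its image, and quotients preserve local connectedness: the preimage of
    a component [G] is relatively open in [C], and the image of the compact
    rest is closed. *)
Lemma locally_connected_image (T U : topologicalType) (C : set T) (f : T -> U) :
  hausdorff_space T -> hausdorff_space U ->
  {within C, continuous f} -> compact C -> locally_connected_set C ->
  locally_connected_set (f @` C).
Proof.
move=> hT hU cf cC lC; apply: locally_connected_closed => W x oW WSx.
set G := connected_component _ x.
have -> : f @` C `\` G = f @` (C `\` f @^-1` G).
  apply/seteqP; split => y; first by move=> [[z Cz <-] nG]; exists z.
  by move=> [z [Cz nG] <-]; split => //; exists z.
apply: compact_closed => //; apply: continuous_compact.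
  by apply: continuous_subspaceW cf; exact: subDsetl.
apply: (subclosed_compact _ cC); last exact: subDsetl.
apply: closed_setD_relopen; first exact: compact_closed.
move=> y Cy Gy; have [Wfy _] := @connected_component_sub _ _ _ _ Gy.
have [V [oV Vy VfW]] := within_continuous_nbhs cf Cy oW Wfy.
have [V' [oV' V'y V'V cV']] := lC y V Cy oV Vy.
exists V'; split => // z VCz; apply: (@connected_component_trans _ _ (f y)) => //.
apply: (@connected_component_max _ _ (f @` (V' `&` C))).
- by exists y.
- move=> _ [t V'Ct <-]; have [_ Ct] := V'Ct.
  by split; [apply: VfW; split => //; exact: V'V | exists t].
- apply: connected_continuous_connected cV' _.
  by apply: continuous_subspaceW cf; exact: subIsetr.
- by exists z.
Qed.

(** * Convex sets, and Peano neighbourhoods in manifolds *)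

Definition segment_convex (R : realType) (V : normedModType R) (A : set V) :=
  forall x y t, A x -> A y -> 0 <= t <= 1 -> A (x + t *: (y - x)).

Lemma segment_convexI (R : realType) (V : normedModType R) (A B : set V) :
  segment_convex A -> segment_convex B -> segment_convex (A `&` B).
Proof.
by move=> cA cB x y t [Ax Bx] [Ay By] t01; split; [exact: cA|exact: cB].
Qed.

Lemma segment_convex_connected (R : realType) (V : normedModType R) (A : set V) :
  segment_convex A -> connected A.
Proof.
move=> cA; have [->|/set0P[x Ax]] := eqVneq A set0; first exact: connected0.
pose seg y := (fun t : R => x + t *: (y - x)) @` `[0, 1]%classic.
have -> : A = \bigcup_(y in A) seg y.
  apply/seteqP; split => [y Ay|_ [y Ay [t t01 <-]]].
    exists y => //; exists 1; rewrite /= ?in_itv/= ?ler01 ?lexx//.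
    by rewrite scale1r addrC subrK.
  exact: cA.
apply: bigcup_connected => [|y Ay].
  exists x => y Ay; exists 0; rewrite /= ?in_itv/= ?ler01 ?lexx//.
  by rewrite scale0r addr0.
apply: connected_continuous_connected; first exact: segment_connected.
apply: continuous_subspaceT => t; apply: cvgD; first exact: cvg_cst.
by apply: cvgZ; [exact: cvg_id|exact: cvg_cst].
Qed.

Lemma normB_segment (R : realType) (V : normedModType R) (c x y : V) (t : R) :
  0 <= t <= 1 ->
  `|c - (x + t *: (y - x))| <= (1 - t) * `|c - x| + t * `|c - y|.
Proof.
move=> /andP[t0 t1].
have -> : c - (x + t *: (y - x)) = (1 - t) *: (c - x) + t *: (c - y).
  have e : t *: (y - x) = t *: (c - x) - t *: (c - y).
    by rewrite -scalerBr opprB [in RHS]addrC addrA subrK.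
  by rewrite opprD addrA e scalerBl scale1r opprB addrA addrAC.
rewrite (le_trans (ler_normD _ _))// !normrZ (ger0_norm t0).
by rewrite (@ger0_norm _ (1 - t)) ?subr_ge0.
Qed.

Lemma segment_convex_ball (R : realType) (V : normedModType R) (c : V) (r : R) :
  segment_convex (ball c r).
Proof.
move=> x y t; rewrite -ball_normE /= => cx cy t01.
rewrite (le_lt_trans (normB_segment _ _ _ t01))//.
have mr : Num.max `|c - x| `|c - y| < r by rewrite gt_max cx.
apply: le_lt_trans mr; move: t01 => /andP[t0 t1].
have xm : `|c - x| <= Num.max `|c - x| `|c - y| by rewrite le_max lexx.
have ym : `|c - y| <= Num.max `|c - x| `|c - y| by rewrite le_max lexx orbT.
by nra.
Qed.

Lemma segment_convex_closed_ball (R : realType) (V : normedModType R) (c : V)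
    (r : R) : 0 < r -> segment_convex (closed_ball c r).
Proof.
move=> r0 x y t; rewrite closed_ballE// /closed_ball_ /= => cx cy t01.
rewrite (le_trans (normB_segment _ _ _ t01))//.
by move: t01 => /andP[t0 t1]; nra.
Qed.

Lemma segment_convex_locally_connected (R : realType) (V : normedModType R)
    (A : set V) : segment_convex A -> locally_connected_set A.
Proof.
move=> cA x W Ax oW Wx; have /nbhs_ballP[e e0 eW] := open_nbhs_nbhs (conj oW Wx).
exists (ball x e); split; first exact: ball_open.
- exact: ballxx.
- by move=> y [/eW].
- apply: segment_convex_connected; apply: segment_convexI => //.
  exact: segment_convex_ball.
Qed.

Lemma cellE (R : realType) (n : nat) :
  @cell R n = [set x | \sum_(i < n) x ord0 i ^+ 2 <= 1].
Proof.
apply/funext => x; rewrite /cell /=; set s := \sum_(i < n) _.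
by rewrite -[X in Num.sqrt s <= X]sqrtr1 ler_sqrt.
Qed.

Lemma segment_convex_cell (R : realType) (n : nat) : segment_convex (@cell R n).
Proof.
move=> x y t; rewrite cellE /= => cx cy /andP[t0 t1].
have /le_trans : \sum_(i < n) (x + t *: (y - x)) ord0 i ^+ 2 <=
    (1 - t) * (\sum_(i < n) x ord0 i ^+ 2) + t * (\sum_(i < n) y ord0 i ^+ 2).
  rewrite !mulr_sumr -big_split; apply: ler_sum => i _; rewrite !mxE /=.
  set a := x ord0 i; set b := y ord0 i.
  have -> : (1 - t) * a ^+ 2 + t * b ^+ 2 =
    (a + t * (b - a)) ^+ 2 + t * (1 - t) * (b - a) ^+ 2 by ring.
  by rewrite lerDl mulr_ge0 ?sqr_ge0// mulr_ge0// subr_ge0.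
by apply; nra.
Qed.

Lemma cell_closed (R : realType) (n : nat) : closed (@cell R n).
Proof.
rewrite cellE; pose f (x : 'rV[R]_n) := \sum_(i < n) x ord0 i ^+ 2.
apply: (@preimage_closed _ _ f [set y | y <= 1]); last exact: closed_le.
move=> x _; apply: cvg_big => [||i _]; first exact: add_continuous.
  exact: nbhs_filter.
apply: (@continuous_comp _ _ _ (fun x : 'rV[R]_n => x ord0 i) (fun y => y ^+ 2)).
  exact: coord_continuous.
exact: exprn_continuous.
Qed.

(** The trace on the cell of a closed ball around the image of [x] in a chart
    is compact and convex, also when [x] lies on the boundary of [M]. *)
Lemma manifold_Peano_nbhs (R : realType) (n : nat) (M : metricType R) (x : M)
    (N : set M) : manifold n M -> nbhs x N ->
  exists2 C, nbhs x C & C `<=` N /\ Peano_continuum C.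
Proof.
move=> [_ /(_ x)[V [W [oV Vx oW [f [g [[fVW gWV] gK fK cf cg]]]]]]] xN.
have [Wfx Cfx] := fVW _ Vx; set B := W `&` @cell R n in fVW gWV fK cg.
have [N' [oN' N'x N'N]] : exists N', [/\ open N', N' x & N' `<=` N].
  by exists N^°; split; [exact: open_interior|exact: xN|exact: interior_subset].
have gN' : N' (g (f x)) by rewrite gK.
have [P [oP Pfx PgN]] := within_continuous_nbhs cg (conj Wfx Cfx) oN' gN'.
have /nbhs_closedballP[r rOW] := open_nbhs_nbhs (conj (openI oP oW) (conj Pfx Wfx)).
pose D := closed_ball (f x) r%:num `&` @cell R n.
have DB : D `<=` B by move=> y [/rOW[_ Wy] Cy].
have cD : {within D, continuous g} by exact: continuous_subspaceW cg.
have sD : segment_convex D.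
  apply: segment_convexI; last exact: segment_convex_cell.
  exact: segment_convex_closed_ball.
have kD : compact D.
  apply: bounded_closed_compact.
    exists (`|f x| + r%:num); split=> [|s rs y []]; first exact: num_real.
    rewrite closed_ballE// /closed_ball_ /= => xy _; apply: le_trans (ltW rs).
    by rewrite -[y in leLHS](subKr (f x)) (le_trans (ler_normB _ _))// lerD2l.
  by apply: closedI; [exact: closed_ball_closed|exact: cell_closed].
exists (g @` D).
  have oB : open (ball (f x) r%:num) by exact: ball_open.
  have Bfx : ball (f x) r%:num (f x) by exact: ballxx.
  have [Q [oQ Qx Qf]] := within_continuous_nbhs cf Vx oB Bfx.
  have : nbhs x (Q `&` V) by apply: open_nbhs_nbhs; split => //; exact: openI.
  apply: filterS => y QVy; exists (f y).
    split; first by apply: subset_closed_ball; exact: Qf.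
    by case: QVy => _ /fVW[].
  by rewrite gK//; case: QVy.
split.
  move=> _ [y Dy <-]; apply: N'N; apply: PgN.
  by split; [case: Dy => /rOW[]|exact: DB].
split; first exact: continuous_compact.
  apply: connected_continuous_connected => //; exact: segment_convex_connected.
apply: locally_connected_image => //.
  exact: metric_hausdorff.
exact: segment_convex_locally_connected.
Qed.


(** * Orbits and minimal sets *)

Section flow.
Context (R : realType) (M : metricType R) (phi : R -> M -> M).
Context (Fphi : C0_flow phi).
Implicit Types (A B K X N : set M).

Lemma flow_continuous (t : R) : continuous (phi t).
Proof.
case: Fphi => cphi _ _ x.
apply: (@continuous_comp _ _ _ (fun y : M => (t, y)) (fun p : R * M => phi p.1 p.2));
  last exact: cphi.
exact: (cvg_pair (cvg_cst t) cvg_id).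
Qed.

Lemma orbit_map_continuous (x : M) : continuous (phi ^~ x).
Proof.
case: Fphi => cphi _ _ t.
apply: (@continuous_comp _ _ _ (fun s : R => (s, x)) (fun p : R * M => phi p.1 p.2));
  last exact: cphi.
exact: (cvg_pair cvg_id (cvg_cst x)).
Qed.

Lemma flow_addE (s t : R) (x : M) : phi s (phi t x) = phi (s + t) x.
Proof. by case: Fphi => _ _ ->. Qed.

Lemma flow_0E (x : M) : phi 0 x = x.
Proof. by case: Fphi. Qed.

Lemma flowK (t : R) : cancel (phi t) (phi (- t)).
Proof. by move=> x; rewrite flow_addE addNr flow_0E. Qed.

Lemma flowVK (t : R) : cancel (phi (- t)) (phi t).
Proof. by move=> x; rewrite flow_addE subrr flow_0E. Qed.

Lemma flow_imageE (t : R) A : phi t @` A = phi (- t) @^-1` A.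
Proof.
apply/seteqP; split => [_ [x Ax <-]|x Ax]; first by rewrite /preimage /= flowK.
by exists (phi (- t) x) => //; rewrite flowVK.
Qed.

Lemma flow_image_open (t : R) A : open A -> open (phi t @` A).
Proof.
rewrite flow_imageE; apply: open_comp => x _; exact: flow_continuous.
Qed.

Definition orbit (x : M) : set M := range (phi ^~ x).

Lemma orbit_refl (x : M) : orbit x x.
Proof. by exists 0; rewrite ?flow_0E. Qed.

Lemma orbit_invariant (x : M) : flow_invariant phi (orbit x).
Proof. by move=> t _ [s _ <-]; exists (t + s); rewrite ?flow_addE. Qed.

Lemma orbit_connected (x : M) : connected (orbit x).
Proof.
apply: connected_continuous_connected; last first.
  by apply: continuous_subspaceT; exact: orbit_map_continuous.
by apply/connected_intervalP => ? ? _ _ ? _.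
Qed.

Lemma sub_invariant_orbit A (x : M) :
  flow_invariant phi A -> A x -> orbit x `<=` A.
Proof. by move=> iA Ax _ [t _ <-]; exact: iA. Qed.

Lemma closure_invariant A : flow_invariant phi A -> flow_invariant phi (closure A).
Proof.
move=> iA t x clx V /(flow_continuous (x := x)) xV.
by have [y [Ay Vy]] := clx _ xV; exists (phi t y); split => //; exact: iA.
Qed.

Lemma minimal_closure_orbit K (x : M) :
  minimal_set phi K -> K x -> closure (orbit x) = K.
Proof.
move=> [_ cK iK mK] Kx; apply: mK.
- by exists x; apply: subset_closure; exact: orbit_refl.
- exact: closed_closure.
- by apply: closure_invariant; exact: orbit_invariant.
- rewrite [X in _ `<=` X](iffLR (closure_id K) cK); apply: closureS.
  exact: sub_invariant_orbit.
Qed.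

Lemma minimal_connected K : minimal_set phi K -> connected K.
Proof.
move=> mK; have [[x Kx] _ _ _] := mK.
rewrite -(minimal_closure_orbit mK Kx); apply: connected_closure.
exact: orbit_connected.
Qed.

Lemma minimal_eq K X (x : M) :
  minimal_set phi K -> minimal_set phi X -> K x -> X x -> K = X.
Proof.
move=> mK mX Kx Xx; rewrite -(minimal_closure_orbit mK Kx).
exact: minimal_closure_orbit.
Qed.

(** Zorn's lemma is applied to the complements in [X] of the nonempty closed
    invariant subsets: the union of a chain of them still has a nonempty
    complement, by compactness. *)
Lemma compact_invariant_minimal X :
  compact X -> X !=set0 -> flow_invariant phi X ->
  exists2 K, K `<=` X & minimal_set phi K.
Proof.
move=> cX X0 iX.
have clX : closed X by apply: compact_closed => //; exact: metric_hausdorff.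
pose P A := [/\ X `\` A !=set0, closed (X `\` A) & flow_invariant phi (X `\` A)].
have [F FP totF|A [[XA0 XAc XAi] maxA]] := @Zorn_bigcup M P.
  have [->|/set0P[A0 FA0]] := eqVneq F set0.
    by rewrite bigcup_set0; split; rewrite setD0.
  have XFE : X `\` \bigcup_(A in F) A = \bigcap_(A in F) (X `\` A).
    apply/seteqP; split => [x [Xx nF] A FA|x XF].
      by split => // Ax; apply: nF; exists A.
    split; first by have [] := XF _ FA0.
    by move=> [A FA Ax]; have [_ /(_ Ax)] := XF _ FA.
  rewrite /P XFE; split.
  - pose G := filter_from F (fun A => X `\` A).
    have GF : ProperFilter G.
      apply: filter_from_proper => [|A /FP[]//].
      apply: filter_from_filter; first by exists A0.
      move=> A B FA FB; have [AB|BA] := totF _ _ FA FB.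
        by exists B => // x [Xx nB]; split; split => // /AB.
      by exists A => // x [Xx nA]; split; split => // /BA.
    have [|x [Xx clx]] := cX G GF; first by exists A0 => // x [].
    exists x => A FA; have [_ + _] := FP _ FA; apply.
    by move=> V xV; apply: clx => //; exists A.
  - by apply: closed_bigI => A /FP[].
  - by move=> t x XF A FA; have [_ _] := FP _ FA; apply; exact: XF.
exists (X `\` A); first exact: subDsetl.
split => // B B0 Bc Bi BXA; apply: contrapT => BneqXA.
apply: (maxA (~` B)).
  split; first by move=> x Ax /BXA[].
  move=> BcA; apply: BneqXA; apply/seteqP; split => // x [Xx nAx].
  by apply: contrapT => /BcA.
by rewrite /P setDE setCK (_ : X `&` B = B)//; apply/setIidPr => x /BXA[].
Qed.

End flow.

(** * Stable minimal sets of non-wandering flows *)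

Section stability.
Context (R : realType) (M : metricType R) (phi : R -> M -> M).
Context (Fphi : C0_flow phi).
Implicit Types (A B K X N : set M).

(** If [phi t x] with [t < 0] were outside the closure of [A], then the points
    of [A] near [x] that come from outside that closure would form a
    neighbourhood of [x] to which no point returns after time [- t], because
    what starts in [A] is by then the image under [phi (- t)] of a point still
    in [A]. *)
Lemma nonwandering_closure_invariant A :
  nonwandering phi -> open A -> positively_invariant phi A ->
  forall (t : R) x, A x -> closure A (phi t x).
Proof.
move=> nw oA pA t x Ax; have [t0|t0] := leP 0 t.
  by apply: subset_closure; exact: pA.
apply: contrapT => nclA.
pose O := ~` closure A.
have oO : open O by apply: closed_openC; exact: closed_closure.
have xV : nbhs x (A `&` phi (- t) @` O).
  apply: open_nbhs_nbhs; split; first by apply: openI => //; exact: flow_image_open.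
  by split => //; exists (phi t x) => //; rewrite flowK.
have [s ts] := nw _ _ xV (- t + 1) ltac:(lra).
move=> [_ [[y [Ay _] <-] [_ [z Oz zE]]]]; apply: Oz; apply: subset_closure.
have <- : phi (t + s) y = z by rewrite -flow_addE// -zE flowVK.
by apply: pA => //; lra.
Qed.

(** The neighbourhood is the union of all time translates of the component
    containing [K] of the interior of a positively invariant neighbourhood. By
    the non-wandering property, backward translates do not leave the closure of
    that component. *)
Lemma stable_invariant_nbhs K N :
  (forall (x : M) B, nbhs x B ->
     exists2 C, nbhs x C & C `<=` B /\ Peano_continuum C) ->
  nonwandering phi -> minimal_set phi K -> compact K -> Lyapunov_stable phi K ->
  set_nbhs K N ->
  exists A, [/\ open A, K `<=` A, connected A, flow_invariant phi A &
                closure A `<=` N /\ compact (closure A)].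
Proof.
move=> lP nw mK cK sK KN; have [[x0 Kx0] _ iK _] := mK.
have [N1 KN1 [cN1 N1N]] : exists2 N1, set_nbhs K N1 & compact N1 /\ N1 `<=` N.
  apply: compact_cover_ind => //.
  - by split; [exact: compact0|].
  - by move=> B C [cB BN] [cC CN]; split; [exact: compactU|rewrite subUset].
  - by move=> x /KN /lP[C xC [CN [cC _ _]]]; exists C.
have clN1 : closed N1 by apply: compact_closed => //; exact: metric_hausdorff.
have [V [KV VN1 pV]] := sK _ KN1.
pose A := connected_component V^° x0.
have KVi : K `<=` V^° by move=> x Kx; exact: KV.
have KA : K `<=` A.
  by apply: connected_component_max => //; exact: (minimal_connected Fphi mK).
have Ax0 := KA _ Kx0.
have oA : open A.
  rewrite openE => x Ax; have Vx := @connected_component_sub _ _ _ _ Ax.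
  have [C xC [CV [_ cC _]]] := lP _ _ (nbhs_interior Vx).
  have Cx := nbhs_singleton xC; apply: filterS xC => y Cy.
  exact: connected_component_trans Ax (connected_component_max Cx CV cC Cy).
have pA : positively_invariant phi A.
  move=> t x t0 Ax; apply: (connected_component_trans (KA _ (iK t _ Kx0))).
  apply: (@connected_component_max _ _ (phi t @` A)); last by exists x.
  - by exists x0.
  - rewrite -open_subsetE; last exact: flow_image_open.
    move=> _ [y Ay <-]; apply: pV => //; apply: interior_subset.
    exact: connected_component_sub Ay.
  - apply: connected_continuous_connected; first exact: component_connected.
    by apply: continuous_subspaceT => y; exact: flow_continuous.
pose A1 := \bigcup_(t in [set: R]) (phi t @` A).
have A1cl : A1 `<=` closure A.
  by move=> _ [t _ [x Ax <-]]; exact: nonwandering_closure_invariant.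
have clA1 : closure A1 `<=` N1.
  have /closure_id clAE := @closed_closure _ A.
  apply: subset_trans (closureS A1cl) _; rewrite -clAE.
  rewrite (iffLR (closure_id N1) clN1); apply: closureS.
  move=> x Ax; apply: VN1; apply: interior_subset.
  exact: connected_component_sub Ax.
exists A1; split.
- by apply: bigcup_open => t _; exact: flow_image_open.
- by move=> x Kx; exists 0 => //; exists x; [exact: KA|exact: flow_0E].
- apply: bigcup_connected => [|t _].
    exists x0 => t _; exists (phi (- t) x0); last exact: flowVK.
    by apply: KA; exact: iK.
  apply: connected_continuous_connected; first exact: component_connected.
  by apply: continuous_subspaceT => y; exact: flow_continuous.
- move=> s _ [t _ [x Ax <-]]; exists (s + t) => //; exists x => //.
  by rewrite flow_addE.
- split; first exact: subset_trans clA1 N1N.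
  exact: subclosed_compact (@closed_closure _ _) cN1 clA1.
Qed.

Lemma hausdorff_ball (K L : hyperspace M) (d e : R) :
  hausdorff_radii K L d -> d < e -> ball K e L.
Proof.
move=> KLd de; rewrite ballEmdist /=.
suff : hausdorff_dist K L < e by [].
apply: le_lt_trans de; apply: ge_inf => //.
by exists 0 => r [/ltW].
Qed.

(** A minimal set near [K] lies in a small ball around [K] for trivial reasons.
    Conversely, every orbit in [K] is dense in [K], so by compactness and
    continuity the orbit of every point close enough to [K] comes close to all
    the points of [K]. *)
Lemma minimal_near_hausdorff (K : hyperspace M) (e : R) :
  minimal_set phi K -> 0 < e ->
  exists2 N, set_nbhs K N &
    forall L : hyperspace M, minimal_set phi L -> L `<=` N -> ball K e L.
Proof.
move=> mK e0; have e20 : 0 < e / 2 by rewrite divr_gt0.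
have e40 : 0 < e / 2 / 2 by rewrite divr_gt0.
have orbit_near : set_nbhs K
    [set y | (K : set M) `<=` [set x | exists t, ball x (e / 2) (phi t y)]].
  have /compact_near_coveringP : compact (K : set M) by exact: hyperspace_compact.
  move=> /(_ _ (set_nbhs K) (fun y x => exists t, ball x (e / 2) (phi t y))).
  apply => x Kx.
  exists (ball x (e / 2 / 2),
          [set y | exists t, ball x (e / 2 / 2) (phi t y)]) => /=.
    split; first exact: nbhsx_ballx.
    move=> y Ky.
    have xB := nbhs_interior (nbhsx_ballx x _ e40).
    have : closure (orbit phi y) x by rewrite (minimal_closure_orbit Fphi mK).
    move=> /(_ _ xB)[_ [[t _ <-] xt]].
    have : nbhs y (phi t @^-1` ball x (e / 2 / 2)).
      exact: (@flow_continuous _ _ _ Fphi t y _ xt).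
    by apply: filterS => z xz; exists t.
  move=> [x' y] /= [xx' [t xt]]; exists t.
  by rewrite [e / 2]splitr; exact: ball_triangle (ball_sym xx') xt.
exists ([set y | (K : set M) `<=` [set x | exists t, ball x (e / 2) (phi t y)]]
   `&` [set y | exists2 x, hyperspace_set K x & ball y (e / 2) x]).
  move=> x Kx; apply: filterI; first exact: orbit_near.
  have := nbhsx_ballx x _ e20.
  by apply: filterS => y xy; exists x => //; exact: ball_sym.
move=> L mL LN; apply: (@hausdorff_ball _ _ (e / 2)); last lra.
split => // [x Kx|y /LN[_ [x Kx]]]; last by rewrite ballEmdist; exists x.
have [y Ly] := hyperspace_neq0 L; have [/(_ _ Kx)[t xt] _] := LN _ Ly.
exists (phi t y); first by have [_ _ iL _] := mL; exact: iL.
by move: xt; rewrite ballEmdist.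
Qed.

End stability.

(** * Sets with the cardinality of the continuum *)

Section cardinality.
Local Open Scope card_scope.

Lemma set_inj_card_le (T U : Type) (A : set T) (B : set U) (f : T -> U) :
  set_fun A B f -> set_inj A f -> A #<= B.
Proof.
move=> fAB fI; have [g] : $|{injfun A >-> B}| by apply/injfunPex; exists f.
exact: inj_card_le g.
Qed.

Lemma card_eq_range (T U : Type) (S : set T) : S #= [set: U] ->
  exists L : U -> T, injective L /\ range L = S.
Proof.
move=> /card_bijP[f [g fK gK]].
pose inU u : [set: U] := SigSub (mem_set (I : setT u)).
exists (fun u => val (g (inU u))); split.
  by move=> u v /val_inj/(can_inj gK)/(congr1 val).
apply/seteqP; split => [_ [u _ <-]|s Ss]; first exact: set_valP.
exists (val (f (SigSub (mem_set Ss)))) => //.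
by rewrite (_ : inU _ = f (SigSub (mem_set Ss))) ?fK//; exact: val_inj.
Qed.

Lemma mdist_continuous (R : realType) (T : metricType R) (a : T) :
  continuous (mdist a : T -> R).
Proof.
move=> x; apply/cvgrPdist_lt => e e0.
have : nbhs x (ball x e) by exact: nbhsx_ballx.
apply: filterS => y; rewrite ballEmdist /= => xy.
have := metric_triangle a x y; have := metric_triangle a y x.
by rewrite (metric_sym y x) ltr_norml; lra.
Qed.

(** By connectedness the distance to [a] takes all the values between [0] and
    [mdist a b]; the function [mdist a b / (1 + expR t)] embeds the real line
    into these values. *)
Lemma connected_card_ge (R : realType) (T : metricType R) (S : set T) (a b : T) :
  connected S -> S a -> S b -> a <> b -> [set: R] #<= S.
Proof.
move=> cS Sa Sb /eqP ab; have d0 : 0 < mdist a b by rewrite mdist_gt0.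
have /connected_intervalP iS : connected ((mdist a : T -> R) @` S).
  apply: connected_continuous_connected => //; apply: continuous_subspaceT.
  exact: mdist_continuous.
have gP (t : R) : exists s, S s /\ mdist a s = mdist a b / (1 + expR t).
  have et := expR_gt0 t.
  have [|||s Ss sE] := iS 0 (mdist a b) _ _ (mdist a b / (1 + expR t)).
  - by exists a => //; exact: mdistxx.
  - by exists b.
  - have p0 : 0 < 1 + expR t by rewrite addr_gt0.
    by rewrite divr_ge0 ?ltW//= ltr_pdivrMr// ltr_pMr//; lra.
  - by exists s.
have [g gE] := choice gP.
apply: (@set_inj_card_le _ _ _ _ g) => [t _|s t _ _ st].
  exact: (gE t).1.
have := (gE s).2; rewrite st (gE t).2 => /(mulfI (lt0r_neq0 d0)) /invr_inj /addrI.
by move=> /expR_inj.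
Qed.

Section binary_sequences.
Context (R : realType).
Implicit Types (a b : nat -> bool).

Let psum a (n : nat) : R := \sum_(i < n) (a i)%:R * 3^-1 ^+ i.

Let psumS a n : psum a n.+1 = psum a n + (a n)%:R * 3^-1 ^+ n.
Proof. by rewrite /psum big_ord_recr. Qed.

Let psum_le a m n : psum a m <= psum a n + 3 / 2 * 3^-1 ^+ n.
Proof.
pose u n := psum a n + 3 / 2 * 3^-1 ^+ n.
have pow_ge0 k : 0 <= 3^-1 ^+ k :> R by rewrite exprn_ge0// invr_ge0.
have digit k : 0 <= ((a k)%:R : R) <= 1 by case: (a k); rewrite ?lexx ?ler01.
have /nondecreasing_seqP ps k : psum a k <= psum a k.+1.
  by rewrite psumS lerDl mulr_ge0//; case/andP: (digit k).
have /nonincreasing_seqP us k : u k.+1 <= u k.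
  rewrite /u psumS exprS; case/andP: (digit k) => _ a1.
  by have := ler_wpM2r (pow_ge0 k) a1; lra.
apply: le_trans (ps _ _ (leq_maxl m n)) _.
apply: le_trans (us _ _ (leq_maxr m n)); rewrite /u lerDl mulr_ge0//; lra.
Qed.

(** The number whose ternary digits, all 0 or 1, are given by [a]; digits in
    base 3 make this injective, with no double expansions. *)
Definition ternary a : R := sup (range (psum a)).

Let psum_ternary a n : psum a n <= ternary a <= psum a n + 3 / 2 * 3^-1 ^+ n.
Proof.
apply/andP; split.
  apply: ub_le_sup; last by exists n.
  by exists (psum a 0 + 3 / 2 * 3^-1 ^+ 0) => _ [m _ <-].
by apply: ge_sup => [|_ [m _ <-]]; [exists (psum a 0), 0%N|].
Qed.

Let ternary_lt a b k : (forall i, (i < k)%N -> a i = b i) -> a k -> ~~ b k ->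
  ternary b < ternary a.
Proof.
move=> ab ak /negbTE bk; have pk : psum a k = psum b k.
  by apply: eq_bigr => i _; rewrite ab.
have /andP[+ _] := psum_ternary a k.+1; have /andP[_ +] := psum_ternary b k.+1.
(* The digits after position [k] contribute at most half of [3^-1 ^+ k]. *)
rewrite !psumS pk ak bk exprS /= mul1r mul0r.
have : 0 < 3^-1 ^+ k :> R by rewrite exprn_gt0// invr_gt0.
set p := 3^-1 ^+ k; lra.
Qed.

Lemma ternary_inj : injective ternary.
Proof.
move=> a b ab; apply/funext => n; elim/ltn_ind : n => k IH.
have [ak|ak] := boolP (a k); have [bk|bk] := boolP (b k) => //.
  by have := ternary_lt IH ak bk; rewrite ab ltxx.
have := @ternary_lt b a k (fun i ik => esym (IH i ik)) bk ak.
by rewrite ab ltxx.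
Qed.

End binary_sequences.

(** A compact set is determined by which balls of radius [1 / k.+1] centred in
    a countable dense set it meets, that is, by a set of natural numbers. *)
Lemma hyperspace_card_le (R : realType) (M : metricType R) :
  separable_space M -> [set: hyperspace M] #<= [set: R].
Proof.
move=> [D /countable_injP[f fI] dD].
pose code (K : hyperspace M) (m : nat) : bool := `[< exists d k,
  [/\ D d, m = pickle (f d, k) & (K : set M) `&` ball d k.+1%:R^-1 !=set0] >].
apply: (@set_inj_card_le _ _ _ _ (fun K => ternary R (code K))) => // K L _ _.
move=> /ternary_inj KL.
have sub (A B : hyperspace M) : code A = code B -> (A : set M) `<=` B.
  move=> AB x Ax; apply: contrapT => nBx.
  have oB : open (~` (B : set M)).
    apply: closed_openC; apply: compact_closed; first exact: metric_hausdorff.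
    exact: hyperspace_compact.
  have /nbhs_ballP[e /= e0 eB] := open_nbhs_nbhs (conj oB nBx).
  have [k ke] : exists k : nat, k.+1%:R^-1 < e / 2.
    have /ltr_add_invr[k] : 0 < e / 2 by rewrite divr_gt0.
    by rewrite add0r; exists k.
  have k0 : 0 < k.+1%:R^-1 :> R by rewrite invr_gt0.
  have [d [xd Dd]] : (ball x k.+1%:R^-1)^° `&` D !=set0.
    by apply: dD; [exists x; exact: nbhsx_ballx|exact: open_interior].
  have xd' := interior_subset xd.
  have : code A (pickle (f d, k)).
    by apply/asboolP; exists d, k; split => //; exists x; split => //; exact: ball_sym.
  rewrite AB => /asboolP[d' [k' [Dd' /(pcan_inj pickleK)[fd kk'] [y [By dy]]]]].
  have dd' : d = d' by apply: fI; rewrite ?inE.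
  apply: (eB y) => //; rewrite [e]splitr; apply: (@ball_triangle _ _ d).
    by apply: le_ball xd'; exact: ltW.
  by rewrite dd'; apply: le_ball dy; rewrite -kk'; exact: ltW.
by apply: hyperspace_inj; apply/seteqP; split; apply: sub.
Qed.

End cardinality.

(** * The decomposition into minimal sets *)

Section decomposition.
Context (R : realType) (M : metricType R) (phi : R -> M -> M).
Context (Fphi : C0_flow phi) (nwphi : nonwandering phi).
Context (Peano_nbhs : forall (x : M) B, nbhs x B ->
  exists2 C, nbhs x C & C `<=` B /\ Peano_continuum C).
Context (X : set M) (cX : compact X) (iX : flow_invariant phi X).
Context (stable_in : forall K : hyperspace M,
  minimal_set phi K -> (K : set M) `<=` X -> Lyapunov_stable phi K).

(** A minimal set [K] in the closure of the orbit of [x] is stable. If [x] were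
    not in [K], then [K] would have an open invariant neighbourhood that avoids
    [x]; but the orbit of [x] enters it. *)
Lemma stable_minimal_cover (x : M) : X x ->
  exists K : hyperspace M, [/\ minimal_set phi K, hyperspace_set K x & K `<=` X].
Proof.
move=> Xx; pose Y := closure (orbit phi x).
have clX : closed X by apply: compact_closed => //; exact: metric_hausdorff.
have YX : Y `<=` X.
  rewrite (iffLR (closure_id X) clX); apply: closureS.
  exact: sub_invariant_orbit.
have cY : compact Y by exact: subclosed_compact (@closed_closure _ _) cX YX.
have [||K KY mK] := @compact_invariant_minimal _ _ phi _ cY.
- by exists x; apply: subset_closure; exact: orbit_refl.
- by apply: closure_invariant => //; exact: orbit_invariant.
have [K0 clK iK _] := mK; have cK := subclosed_compact clK cY KY.
pose HK := Hyperspace K0 cK.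
have KX : K `<=` X by exact: subset_trans KY YX.
exists HK; split => //; apply: contrapT => nKx.
have Kx : set_nbhs K (~` [set x]).
  move=> y Ky; apply: open_nbhs_nbhs; split.
    apply: closed_openC; apply: compact_closed; first exact: metric_hausdorff.
    exact: compact_set1.
  by move=> yx; apply: nKx; rewrite -yx.
have [A [oA KA _ iA [clA _]]] :=
  stable_invariant_nbhs Fphi Peano_nbhs nwphi mK cK (@stable_in HK mK KX) Kx.
have [k Kk] := K0.
have [_ [[t _ <-] At]] := KY _ Kk _ (open_nbhs_nbhs (conj oA (KA _ Kk))).
apply: (clA x) => //; apply: subset_closure.
by rewrite -(flowK Fphi t x); exact: iA.
Qed.

(** Near [x], points lie in a small invariant neighbourhood of the stable set
    [q x], so their minimal sets are contained in its closure and hence close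
    to [q x]. The set [K0] is only a default value for [q] outside [X]. *)
Lemma stable_decomposition (K0 : hyperspace M) : exists q : M -> hyperspace M,
  (forall x, X x ->
     [/\ minimal_set phi (q x), hyperspace_set (q x) x & q x `<=` X])
  /\ {within X, continuous q}.
Proof.
have qP x : exists K : hyperspace M, X x ->
    [/\ minimal_set phi K, hyperspace_set K x & K `<=` X].
  have [/stable_minimal_cover[K KP]|nXx] := pselect (X x); first by exists K.
  by exists K0.
have [q {}qP] := choice qP; exists q; split => //.
apply/subspace_continuousP => x Xx; have [mq qx qX] := qP _ Xx.
apply/cvg_ballP => e e0.
have [N qN NP] := minimal_near_hausdorff Fphi mq e0.
have [A [oA qA _ iA [clA _]]] := stable_invariant_nbhs Fphi Peano_nbhs nwphi mq
  (@hyperspace_compact _ _ (q x)) (stable_in mq qX) qN.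
have : nbhs x A by apply: open_nbhs_nbhs; split => //; exact: qA.
apply: filterS => y Ay Xy; have [mqy qy _] := qP _ Xy.
apply: NP => //; rewrite -(minimal_closure_orbit Fphi mqy qy).
apply: subset_trans clA; apply: closureS; exact: sub_invariant_orbit.
Qed.

End decomposition.

Lemma clopen_connected_setT (T : topologicalType) (K : set T) :
  connected [set: T] -> K !=set0 -> open K -> closed K -> K = setT.
Proof. by move=> cT K0 oK cK; apply: cT => //; exists K; rewrite ?setTI. Qed.

(** The finite union stays connected because each piece meets the connected
    set [K]; for this, the induction carries along the connectedness of
    [K `|` C]. *)
Lemma Peano_cover (R : realType) (M : metricType R) (K X : set M) :
  (forall (x : M) B, nbhs x B ->
     exists2 C, nbhs x C & C `<=` B /\ Peano_continuum C) ->
  compact K -> connected K -> K !=set0 -> set_nbhs K X ->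
  exists2 C, set_nbhs K C & C `<=` X /\ Peano_continuum C.
Proof.
move=> lP cK coK [k Kk] KX.
pose P C := [/\ compact C, locally_connected_set C, connected (K `|` C) & C `<=` X].
have [C KC [cC lC coC CX]] : exists2 C, set_nbhs K C & P C.
  apply: compact_cover_ind => //.
  - by split; [exact: compact0|move=> ? ? []|rewrite setU0|].
  - move=> A B [cA lA coA AX] [cB lB coB BX]; split.
    + exact: compactU.
    + by apply: locally_connected_setU => //; apply: compact_closed => //;
        exact: metric_hausdorff.
    + by rewrite setUUr; apply: connectedU => //; exists k; split; left.
    + by rewrite subUset.
  - move=> x Kx; have [C xC [CX [cC coC lC]]] := lP _ _ (KX _ Kx).
    exists C => //; split => //; apply: connectedU => //.
    by exists x; split => //; exact: nbhs_singleton.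
exists C => //; split => //; split => //.
by move: coC; rewrite setUidr// => x /KC/nbhs_singleton.
Qed.

Theorem mainTheorem1 (R : realType) (n : nat) (M : metricType R)
    (phi : R -> M -> M) (Lam : hyperspace M) :
  manifold n M -> connected [set: M] ->
  C0_flow phi -> nonwandering phi ->
  minimal_set phi Lam ->
  [\/ exists Lam_ : nat -> hyperspace M,
        (forall k, minimal_set phi (Lam_ k) /\ Lyapunov_unstable phi (Lam_ k))
        /\ Lam_ @ \oo --> Lam,
      [/\ (Lam : set M) = [set: M], compact [set: M] & minimal_flow phi]
    | forall N : set M, set_nbhs Lam N ->
        exists U : set M,
          [/\ set_nbhs Lam U, U `<=` N, compact U, connected U &
              flow_invariant phi U]
          /\ exists L : R -> hyperspace M,
              [/\ injective L,
                  forall i, minimal_set phi (L i) /\ Lyapunov_stable phi (L i),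
                  U = \bigcup_(i in [set: R]) (L i : set M) &
                  Peano_continuum (range L)]].
Proof.
move=> mM cM Fphi nwphi mLam.
have lP (x : M) B (xB : nbhs x B) := manifold_Peano_nbhs mM xB.
have cLam : compact (Lam : set M) by exact: hyperspace_compact.
have [x0 Lx0] := hyperspace_neq0 Lam.
have [unst|/existsNP[e /not_implyP[e0 stab]]] := pselect (forall e : R, 0 < e ->
    exists K : hyperspace M,
      [/\ ball Lam e K, minimal_set phi K & Lyapunov_unstable phi K]).
  apply: Or31; have k0 k : 0 < k.+1%:R^-1 :> R by rewrite invr_gt0.
  have [L LP] := choice (fun k => unst _ (k0 k)); exists L; split.
    by move=> k; have [_ ? ?] := LP k.
  apply/cvg_ballP => e e0; near=> k; have [Lk _ _] := LP k.
  apply: le_ball Lk; apply: ltW; near: k.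
  exact: (near_infty_natSinv_lt (PosNum e0)).
have {}stab (K : hyperspace M) :
    minimal_set phi K -> ball Lam e K -> Lyapunov_stable phi K.
  by move=> mK LK; apply: contrapT => uK; apply: stab; exists K.
have [LT|LnT] := pselect ((Lam : set M) = [set: M]).
  by apply: Or32; rewrite /minimal_flow -LT.
apply: Or33 => N LN.
have [N1 LN1 N1P] := minimal_near_hausdorff Fphi mLam e0.
have sLam : Lyapunov_stable phi Lam by apply: stab => //; exact: ballxx.
have LNN1 : set_nbhs Lam (N `&` N1).
  by move=> x Lx; apply: filterI; [exact: LN|exact: LN1].
have [A [oA LA _ iA [clA cX]]] :=
  stable_invariant_nbhs Fphi lP nwphi mLam cLam sLam LNN1.
set X := closure A in clA cX.
have iX : flow_invariant phi X by exact: closure_invariant.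
have stX (K : hyperspace M) : minimal_set phi K -> (K : set M) `<=` X ->
    Lyapunov_stable phi K.
  by move=> mK KX; apply: stab => //; apply: N1P => // x /KX/clA[].
have LX : set_nbhs Lam X.
  move=> x Lx; apply: filterS (@subset_closure _ A) _.
  by apply: open_nbhs_nbhs; split => //; exact: LA.
have [q [qP cq]] := stable_decomposition Fphi nwphi lP cX iX stX Lam.
have qE x y : X x -> X y -> hyperspace_set (q x) y -> q y = q x.
  move=> Xx Xy qxy; have [mqx _ _] := qP _ Xx; have [mqy qyy _] := qP _ Xy.
  exact: hyperspace_inj (minimal_eq Fphi mqy mqx qyy qxy).
have [C LC [CX [cC coC lC]]] := Peano_cover lP cLam (minimal_connected Fphi mLam)
  (hyperspace_neq0 Lam) LX.
have LsC : (Lam : set M) `<=` C by move=> x /LC/nbhs_singleton.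
have cqC : {within C, continuous q} by exact: continuous_subspaceW cq.
have PS : Peano_continuum (q @` C).
  split; first exact: continuous_compact.
    exact: connected_continuous_connected.
  by apply: locally_connected_image => //; exact: metric_hausdorff.
pose U := \bigcup_(x in C) (q x : set M).
have CU : C `<=` U by move=> x Cx; exists x => //; have [] := qP _ (CX _ Cx).
have UX : U `<=` X by move=> y [x /CX/qP[_ _]]; exact.
have clU : closed U.
  have clS : closed (q @` C).
    by apply: compact_closed; [exact: metric_hausdorff|case: PS].
  have /continuous_closedP/(_ _ clS)/closed_subspaceP[V clV VX] := cq.
  (* [U] is the preimage of [q @` C] in [X]. *)
  suff -> : U = V `&` X by apply: closedI => //; exact: closed_closure.
  rewrite VX; apply/seteqP; split => [y [x Cx qxy]|y [[x Cx xy] Xy]].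
    have Xy : X y by apply: UX; exists x.
    by split => //; exists x => //; apply/esym/qE => //; exact: CX.
  by exists x => //; rewrite xy; have [] := qP _ Xy.
have qL : q x0 = Lam.
  have [mq qx0 _] := qP _ (CX _ (LsC _ Lx0)).
  exact: hyperspace_inj (minimal_eq Fphi mq mLam qx0 Lx0).
(* If [Lam] were the only minimal set meeting [C], it would contain its
   neighbourhood [C], hence be open. *)
have [c Cc qc] : exists2 c, C c & q c <> Lam.
  apply: contrapT => nC; apply: LnT; apply: clopen_connected_setT => //.
  - by exists x0.
  - rewrite openE => x Lx; apply: filterS (LC _ Lx) => c Cc.
    have [_ qcc _] := qP _ (CX _ Cc).
    by have <- : q c = Lam by apply: contrapT => qc; apply: nC; exists c.
  - by apply: compact_closed => //; exact: metric_hausdorff.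
have [L [injL LS]] : exists L : R -> hyperspace M, injective L /\ range L = q @` C.
  apply: card_eq_range; rewrite card_eq_le; apply/andP; split.
    apply: card_le_trans (card_leT _) _; apply: hyperspace_card_le; exact: mM.1.
  have [_ coS _] := PS; apply: (connected_card_ge coS _ _ qc); first by exists c.
  by exists x0 => //; exact: LsC.
have LP i : exists2 x, C x & q x = L i.
  by have : range L (L i) by []; rewrite LS.
exists U; split.
  split.
  - by move=> x Lx; apply: filterS CU _; exact: LC.
  - by move=> x /UX/clA[].
  - exact: subclosed_compact clU cX UX.
  - have -> : U = \bigcup_(x in C) ((q x : set M) `|` C).
      apply/seteqP; split => [y [x Cx qxy]|y [x Cx [qxy|Cy]]].
      + by exists x => //; left.
      + by exists x.
      + exact: CU.
    apply: bigcup_connected => [|x Cx].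
      by exists x0 => x Cx; right; exact: LsC.
    have [mq qx _] := qP _ (CX _ Cx); apply: connectedU => //.
      by exists x.
    exact: minimal_connected mq.
  - move=> t y [x Cx qxy]; exists x => //.
    have [[_ _ iq _] _ _] := qP _ (CX _ Cx).
    exact: iq.
exists L; split => //; last by rewrite LS.
- move=> i; have [x Cx <-] := LP i; have [mq _ qX] := qP _ (CX _ Cx).
  by split => //; exact: stX.
- apply/seteqP; split => [y [x Cx qxy]|y [i _ Liy]].
    have [i _ LE] : range L (q x) by rewrite LS; exists x.
    by exists i => //; rewrite LE.
  by have [x Cx xE] := LP i; exists x => //; rewrite xE.
Unshelve. all: by end_near. Qed.
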